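(* Let $p\in\mathbb{N}$ and let $f$ be analytic and $p$-symmetric in the unit disk $\mathbb{D}=\{z\in\mathbb{C}:|z|<1\}$, i.e. $f(z)=z\sum_{k=0}^{\infty}a_{pk+1}z^{pk}$, with $|f(z)|\le 1$ for all $z\in\mathbb{D}$. Then $$M_f(r)=\sum_{k=0}^{\infty}|a_{pk+1}|r^{pk+1}\le 1\quad\text{for all } 0\le r\le r_p,$$ where $r_p$ is the maximal positive root in $(0,1)$ of the equation $$-6r^{p-1}+r^{2(p-1)}+8r^{2p}+1=0.$$ Moreover, the radius $r_p$ is attained by the extremal function $f(z)=z(z^p-a)/(1-az^p)$ with $$a=\left(1-\frac{\sqrt{1-r_p^{2p}}}{\sqrt{2}}\right)\frac{1}{r_p^{p}},$$ in the sense that the largest $r$ for which $M_f(r)\le 1$ holds for this function equals $r_p$.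
   Context: For $f(z)=\sum_{n\ge0}a_nz^n$ analytic in $\mathbb{D}$, $M_f(r)=\sum_{n\ge 0}|a_n|r^n$ (the majorant series). A function $f$ analytic in $\mathbb{D}$ is called $p$-symmetric if it has the form $f(z)=z\sum_{k=0}^\infty a_{pk+1}z^{pk}$. *)

(* Defs.v *)
From Stdlib Require Import Reals.
From Coquelicot Require Import Coquelicot.
Open Scope R_scope.

(* A function analytic in the unit disk is represented by its Taylor
   coefficient sequence a, whose power series converges in the whole disk. *)
Definition analytic_in_disk (a : nat -> C) : Prop :=
  forall z : C, Cmod z < 1 -> ex_series (fun n => (a n * z ^ n)%C).

Definition bounded_by_one_in_disk (a : nat -> C) : Prop :=
  forall (z w : C), Cmod z < 1 -> is_series (fun n => (a n * z ^ n)%C) w ->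
    Cmod w <= 1.

Definition p_symmetric (p : nat) (a : nat -> C) : Prop :=
  forall n : nat, (forall k : nat, n <> (p * k + 1)%nat) -> a n = 0%C.

Definition bohr_majorant (a : nat -> C) (r : R) : R :=
  Series (fun n => Cmod (a n) * r ^ n).

Definition rp_poly (p : nat) (r : R) : R :=
  - 6 * r ^ (p - 1) + r ^ (2 * (p - 1)) + 8 * r ^ (2 * p) + 1.

Definition is_rp (p : nat) (r : R) : Prop :=
  0 < r < 1 /\ rp_poly p r = 0 /\
  (forall s : R, 0 < s < 1 -> rp_poly p s = 0 -> s <= r).

Definition extremal_a (p : nat) (r : R) : R :=
  (1 - sqrt (1 - r ^ (2 * p)) / sqrt 2) / r ^ p.

Definition extremal_f (p : nat) (a : R) (z : C) : C :=
  (z * (z ^ p - RtoC a) / (1 - RtoC a * z ^ p))%C.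

(* Main.v *)
Require Import Defs.
From Stdlib Require Import Reals Arith Lra Lia.
From Coquelicot Require Import Coquelicot.
Open Scope R_scope.

(** Write [f = z g(z^p)] with [g = sum b_k z^k], [A = |b_0|], [x = r^p] and
    [y = r^(p-1)].  Parseval on circles applied to [f (1 + c z^m)], which is
    dominated by [1 + c z^m], gives for the best [c]
    [(1 - A^2) sum_(1 <= k < N) |b_k|^2 + |b_N|^2 <= (1 - A^2)^2],
    and Abel summation turns this into
    [sum_(k >= 1) |b_k|^2 rho^k <= rho (1 - A^2)^2 / (1 - A^2 rho)] for [rho <= 1].
    By AM-GM with [rho = x / A] if [A >= x], and [rho = 1] if [A < x],
    [sum_(k >= 1) |b_k| x^k] is at most [x (1 - A^2) / (1 - A x)], respectively
    small enough that the total is at most [2 x].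
    With [u = 1 - A x] the desired bound [1 / r = y / x] for
    [A + x (1 - A^2) / (1 - A x)] reads [2 u^2 - (3 - y) u + (1 - x^2) >= 0],
    a quadratic whose discriminant is [rp_poly p r]; it vanishes at [r_p], and
    the double root [u = (3 - y) / 4] is the extremal parameter.
    Coefficients of the extremal function are identified by Parseval again, as a
    power series vanishing on the disk has zero coefficients. *)

(** * Parseval on roots of unity *)

(* [ring] does not see through Coquelicot's canonical structures on [C] and [R]. *)
Ltac Cring :=
  match goal with |- @eq _ ?a ?b => change (@eq C a b) end; ring.
Ltac Rring :=
  match goal with |- @eq _ ?a ?b => change (@eq R a b) end; ring.

Lemma sum_n_nonneg (u : nat -> R) (N : nat) :
  (forall n, 0 <= u n) -> 0 <= sum_n u N.
Proof.
  intros H; induction N as [|N IH].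
  - rewrite sum_O; apply H.
  - rewrite sum_Sn; change plus with Rplus; specialize (H (S N)); lra.
Qed.

Lemma sum_n_nonneg_mono (u : nat -> R) (N M : nat) :
  (forall n, 0 <= u n) -> (N <= M)%nat -> sum_n u N <= sum_n u M.
Proof.
  intros H; induction 1 as [|M _ IH]; [lra|].
  rewrite sum_Sn; change plus with Rplus; specialize (H (S M)); lra.
Qed.

Lemma sum_n_zero {G : AbelianMonoid} (u : nat -> G) (N : nat) :
  (forall n, (n <= N)%nat -> u n = zero) -> sum_n u N = zero.
Proof.
  induction N as [|N IH]; intros H.
  - rewrite sum_O; auto.
  - rewrite sum_Sn, IH, H; auto using plus_zero_l.
Qed.

(** The order is [S q], because [sum_n _ q] has the [q + 1] terms [j = 0, ..., q] and so runs once
    over all the roots. *)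
Definition root_of_unity (q : nat) : C :=
  (cos (2 * PI / INR (S q)), sin (2 * PI / INR (S q))).

Lemma Cpow_cos_sin (t : R) (n : nat) :
  ((cos t, sin t) ^ n)%C = (cos (INR n * t), sin (INR n * t)).
Proof.
  induction n as [|n IH].
  - simpl INR; rewrite Rmult_0_l, cos_0, sin_0; reflexivity.
  - rewrite Cpow_S, IH, S_INR.
    replace ((INR n + 1) * t) with (t + INR n * t) by ring.
    rewrite cos_plus, sin_plus; unfold Cmult; simpl; f_equal; ring.
Qed.

Lemma root_of_unity_pow (q : nat) : (root_of_unity q ^ S q)%C = 1%C.
Proof.
  unfold root_of_unity; rewrite Cpow_cos_sin.
  replace (INR (S q) * (2 * PI / INR (S q))) with (2 * PI)
    by (field; apply not_0_INR; lia).
  now rewrite cos_2PI, sin_2PI.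
Qed.

Lemma root_of_unity_primitive (q m : nat) :
  (0 < m <= q)%nat -> (root_of_unity q ^ m)%C <> 1%C.
Proof.
  intros [H1 H2] E; unfold root_of_unity in E; rewrite Cpow_cos_sin in E.
  set (t := INR m * (2 * PI / INR (S q))) in E.
  assert (Hq : 0 < INR (S q)) by (apply lt_0_INR; lia).
  assert (Hm : 0 < INR m) by (apply lt_0_INR; lia).
  assert (Hmq : INR m < INR (S q)) by (apply lt_INR; lia).
  assert (HPI := PI_RGT_0).
  assert (Ht : 0 < t < 2 * PI).
  { replace t with (2 * PI * (INR m / INR (S q))) by (unfold t; field; lra).
    split.
    - apply Rmult_lt_0_compat; [lra|]; apply Rdiv_lt_0_compat; lra.
    - rewrite <- (Rmult_1_r (2 * PI)) at 2; apply Rmult_lt_compat_l; [lra|].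
      apply -> Rdiv_lt_1; lra. }
  (* As [cos t = 1 - 2 sin^2 (t / 2)], positivity of [sin (t / 2)] excludes [cos t = 1]. *)
  assert (Hs : 0 < sin (t / 2)) by (apply sin_gt_0; lra).
  injection E; intros _ Hc.
  replace t with (2 * (t / 2)) in Hc by field.
  rewrite cos_2a_sin in Hc; nra.
Qed.

Lemma root_of_unity_conj (q : nat) :
  (root_of_unity q * Cconj (root_of_unity q))%C = 1%C.
Proof.
  unfold root_of_unity, Cmult, Cconj; simpl.
  set (t := 2 * PI / _).
  assert (H := sin2_cos2 t); unfold Rsqr in H.
  unfold RtoC; f_equal; lra.
Qed.

Lemma root_of_unity_Cmod (q : nat) : Cmod (root_of_unity q) = 1.
Proof.
  apply Rsqr_inj; [apply Cmod_ge_0|lra|].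
  rewrite Rsqr_1; unfold Rsqr; rewrite <- (Cmod_conj (root_of_unity q)) at 2.
  rewrite <- Cmod_mult, root_of_unity_conj; apply Cmod_1.
Qed.

Lemma Cgeometric_sum (z : C) (N : nat) :
  ((1 - z) * sum_n (fun j => z ^ j) N)%C = (1 - z ^ S N)%C.
Proof.
  induction N as [|N IH].
  - rewrite sum_O; simpl; ring.
  - rewrite sum_Sn; change plus with Cplus.
    rewrite Cmult_plus_distr_l, IH, (Cpow_S z (S N)); ring.
Qed.

(** The summand is [z ^ j] with [z] the conjugate of [w ^ (n - k)]. Primitivity gives [z <> 1] while
    [z ^ S q = 1], so the geometric sum vanishes. *)
Lemma root_of_unity_orthogonal (q k n : nat) :
  (k < n <= q)%nat ->
  sum_n (fun j => (root_of_unity q ^ j) ^ k * Cconj ((root_of_unity q ^ j) ^ n))%C q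
    = RtoC 0.
Proof.
  intros [Hk Hn].
  set (w := root_of_unity q).
  set (z := (w ^ k * Cconj w ^ n)%C).
  rewrite (sum_n_ext _ (fun j => z ^ j)%C).
  2: { intros j; unfold z; rewrite Cpow_mult_l, !Cpow_conj, <- !Cpow_mult_r.
       now rewrite (Nat.mul_comm k), (Nat.mul_comm n). }
  assert (Hz : z = Cconj (w ^ (n - k))%C).
  { unfold z; replace n with (k + (n - k))%nat at 1 by lia.
    rewrite Cpow_add_r, Cmult_assoc, <- Cpow_mult_l.
    unfold w; rewrite root_of_unity_conj, Cpow_1_l, Cpow_conj; ring. }
  assert (Hz1 : z <> 1%C).
  { intros E; apply (root_of_unity_primitive q (n - k)); [lia|].
    rewrite <- (Cconj_conj (_ ^ _)); fold w; rewrite <- Hz, E.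
    unfold Cconj; simpl; unfold RtoC; f_equal; ring. }
  assert (HzS : (z ^ S q)%C = 1%C).
  { rewrite Hz, <- Cpow_conj, <- Cpow_mult_r, Nat.mul_comm, Cpow_mult_r.
    unfold w; rewrite root_of_unity_pow, Cpow_1_l.
    unfold Cconj; simpl; unfold RtoC; f_equal; ring. }
  assert (H := Cgeometric_sum z q); rewrite HzS in H.
  assert (Hd : (1 - z)%C <> 0%C).
  { intros E; apply Hz1; replace z with (1 - (1 - z))%C by ring; rewrite E; ring. }
  apply (f_equal (Cmult (/ (1 - z)))%C) in H.
  rewrite Cmult_assoc, Cinv_l, Cmult_1_l in H by exact Hd.
  rewrite H; Cring.
Qed.

Lemma Cmod_plus_sqr (z w : C) :
  Cmod (z + w) ^ 2 = Cmod z ^ 2 + Cmod w ^ 2 + 2 * Re (z * Cconj w)%C.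
Proof. rewrite !Cmod2_alt; destruct z, w; simpl; ring. Qed.

Lemma Re_sum_n (u : nat -> C) (N : nat) :
  Re (sum_n u N) = sum_n (fun n => Re (u n)) N.
Proof.
  induction N as [|N IH]; [now rewrite !sum_O|].
  now rewrite !sum_Sn, <- IH.
Qed.

Lemma polynomial_orthogonal (q k n : nat) (e : nat -> C) :
  (k < n <= q)%nat ->
  sum_n (fun j => sum_n (fun i => e i * (root_of_unity q ^ j) ^ i) k
                    * Cconj ((root_of_unity q ^ j) ^ n))%C q = RtoC 0.
Proof.
  intros H.
  rewrite (sum_n_ext _ (fun j => sum_n (fun i => e i *
     ((root_of_unity q ^ j) ^ i * Cconj ((root_of_unity q ^ j) ^ n))) k))%C.
  2: { intros j; rewrite <- (sum_n_mult_r (K := C_Ring)).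
       apply sum_n_ext; intros i; change mult with Cmult; Cring. }
  rewrite sum_n_switch; apply (sum_n_zero (G := C_AbelianMonoid)); intros i Hi.
  rewrite (sum_n_mult_l (K := C_Ring)).
  rewrite root_of_unity_orthogonal by lia.
  apply Cmult_0_r.
Qed.

(** Induction on the degree: the cross term between the new monomial and the lower ones sums to zero
    by orthogonality. The bound [N <= q] keeps distinct exponents distinct modulo [q + 1]. *)
Lemma parseval_root_of_unity (q N : nat) (e : nat -> C) :
  (N <= q)%nat ->
  sum_n (fun j => Cmod (sum_n (fun n => e n * (root_of_unity q ^ j) ^ n)%C N) ^ 2) q
    = INR (S q) * sum_n (fun n => Cmod (e n) ^ 2) N.
Proof.
  intros HN; induction N as [|N IH].
  - rewrite sum_O, <- sum_n_const; apply sum_n_ext; intros j.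
    rewrite sum_O; simpl Cpow; now rewrite Cmult_1_r.
  - set (w := root_of_unity q) in *.
    rewrite (sum_n_ext _ (fun j => plus (plus
        (Cmod (sum_n (fun n => e n * (w ^ j) ^ n)%C N) ^ 2) (Cmod (e (S N)) ^ 2))
        (2 * Re (sum_n (fun n => e n * (w ^ j) ^ n) N
           * Cconj ((w ^ j) ^ S N) * Cconj (e (S N)))%C))).
    2: { intros j; rewrite sum_Sn; change (@plus _) with Rplus at 2 3.
         change (plus (sum_n ?u N) ?v) with (Cplus (sum_n u N) v).
         rewrite Cmod_plus_sqr; f_equal; [f_equal|].
         - rewrite Cmod_mult, !Cmod_pow.
           unfold w; rewrite root_of_unity_Cmod, !pow1; ring.
         - rewrite Cmult_conj; do 2 f_equal; ring. }
    rewrite !sum_n_plus, IH, sum_n_const by lia.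
    rewrite (sum_n_mult_l (K := R_Ring)), <- Re_sum_n.
    rewrite (sum_n_mult_r (K := C_Ring)).
    unfold w; rewrite polynomial_orthogonal by lia.
    rewrite (sum_Sn (fun n => Cmod (e n) ^ 2)).
    change mult with Rmult at 1; change plus with Rplus.
    change (Re _) with (Re (0 * Cconj (e (S N)))%C).
    rewrite Cmult_0_l; change (Re 0) with 0; Rring.
Qed.

(** * Coefficients of a dominated power series *)

Lemma is_series_C_approx (u : nat -> C) (w : C) (eps : R) :
  is_series u w -> 0 < eps ->
  exists N, forall n, (N <= n)%nat -> Cmod (w - sum_n u n) < eps.
Proof.
  intros H He.
  destruct (proj1 (filterlim_locally_ball_norm _ _) H (mkposreal _ He)) as [N HN].
  exists N; intros n Hn; specialize (HN n Hn).
  change (Cmod (sum_n u n - w) < eps) in HN.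
  rewrite <- Cmod_opp.
  now replace (- (w - sum_n u n))%C with (sum_n u n - w)%C by ring.
Qed.

Lemma is_series_C_term_lt (u : nat -> C) (w : C) :
  is_series u w -> exists N, forall n, (N < n)%nat -> Cmod (u n) < 2.
Proof.
  intros H; destruct (is_series_C_approx u w 1 H Rlt_0_1) as [N HN].
  exists N; intros n Hn; destruct n as [|n]; [lia|].
  assert (H1 := HN n ltac:(lia)); assert (H2 := HN (S n) ltac:(lia)).
  rewrite sum_Sn in H2; change plus with Cplus in H2.
  set (t := sum_n u n) in *.
  replace (u (S n)) with ((w - t) + - (w - (t + u (S n))))%C by ring.
  eapply Rle_lt_trans; [apply Cmod_triangle|].
  rewrite Cmod_opp; lra.
Qed.

(** Convergence at a point [t] between [s] and 1 bounds the terms there by 2 eventually, and the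
    series at [s] is then compared with a geometric one of ratio [s / t]. *)
Lemma analytic_abs_summable (a : nat -> C) (s : R) :
  analytic_in_disk a -> 0 <= s < 1 -> ex_series (fun n => Cmod (a n) * s ^ n).
Proof.
  intros Ha Hs; set (t := (s + 1) / 2).
  assert (Ht : 0 < t < 1) by (unfold t; lra).
  destruct (Ha (RtoC t)) as [w Hw].
  { rewrite Cmod_R, Rabs_pos_eq; lra. }
  destruct (is_series_C_term_lt _ _ Hw) as [N HN].
  apply (ex_series_incr_n _ (S N)).
  assert (Hq : 0 <= s / t < 1).
  { split; [apply Rdiv_le_0_compat; lra|apply -> Rdiv_lt_1; unfold t; lra]. }
  apply (ex_series_le (V := R_CompleteNormedModule) _
           (fun k => 2 * (s / t) ^ (S N + k))).
  - intros k; specialize (HN (S N + k)%nat ltac:(lia)).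
    set (n := (S N + k)%nat) in *.
    rewrite Cmod_mult, Cmod_pow, Cmod_R, (Rabs_pos_eq t) in HN by lra.
    change (Rabs (Cmod (a n) * s ^ n) <= 2 * (s / t) ^ n).
    assert (0 <= (s / t) ^ n) by (apply pow_le; lra).
    assert (0 <= s ^ n) by (apply pow_le; lra).
    assert (0 <= Cmod (a n)) by apply Cmod_ge_0.
    rewrite Rabs_pos_eq by now apply Rmult_le_pos.
    replace (s ^ n) with (t ^ n * (s / t) ^ n)
      by (rewrite <- Rpow_mult_distr; f_equal; field; lra).
    rewrite <- Rmult_assoc; apply Rmult_le_compat_r; lra.
  - apply (ex_series_incr_n (fun n => 2 * (s / t) ^ n) (S N)).
    apply (ex_series_scal (K := R_AbsRing) (V := R_NormedModule) 2).
    apply ex_series_geom; rewrite Rabs_pos_eq; lra.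
Qed.

Lemma Cmod_sum_n_diff_le (u : nat -> C) (v : nat -> R) (N M : nat) :
  (forall n, Cmod (u n) <= v n) -> (N <= M)%nat ->
  Cmod (sum_n u M - sum_n u N) <= sum_n v M - sum_n v N.
Proof.
  intros H; induction 1 as [|M _ IH].
  - replace (sum_n u N - sum_n u N)%C with (RtoC 0) by ring.
    rewrite Cmod_0; lra.
  - rewrite !sum_Sn; change (@plus C_AbelianMonoid) with Cplus;
      change (@plus R_AbelianMonoid) with Rplus.
    replace (sum_n u M + u (S M) - sum_n u N)%C
      with ((sum_n u M - sum_n u N) + u (S M))%C by ring.
    eapply Rle_trans; [apply Cmod_triangle|].
    specialize (H (S M)); lra.
Qed.

(** A single [N] serves the whole circle, since the tails are dominated by those of the absolute
    series at [s]. This uniformity is needed because the sample points on the circle depend on the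
    truncation degree. *)
Lemma partial_sum_uniform (a : nat -> C) (s eps : R) :
  analytic_in_disk a -> 0 <= s < 1 -> 0 < eps ->
  exists N, forall n z w, (N <= n)%nat -> Cmod z = s ->
    is_series (fun k => a k * z ^ k)%C w ->
    Cmod (sum_n (fun k => a k * z ^ k)%C n) <= Cmod w + eps.
Proof.
  intros Ha Hs He.
  set (v := fun k => Cmod (a k) * s ^ k).
  assert (Hv : is_series v (Series v))
    by (apply Series_correct, analytic_abs_summable; assumption).
  assert (Hv0 : forall k, 0 <= v k)
    by (intros k; apply Rmult_le_pos; [apply Cmod_ge_0|apply pow_le; lra]).
  destruct (proj1 (filterlim_locally _ _) Hv (mkposreal (eps / 4) ltac:(lra)))
    as [N HN].
  assert (HN' : forall n, (N <= n)%nat -> Rabs (sum_n v n - Series v) < eps / 4)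
    by exact HN.
  exists N; intros n z w Hn Hz Hw.
  (* [M] depends on [z], but it only serves to approximate [w]; the estimate between [n] and [m]
     does not involve its size. *)
  destruct (is_series_C_approx _ _ (eps / 4) Hw ltac:(lra)) as [M HM].
  set (m := Nat.max n M).
  assert (H1 := HM m ltac:(lia)).
  assert (H2 := Cmod_sum_n_diff_le (fun k => a k * z ^ k)%C v n m).
  lapply H2; [clear H2; intros H2; specialize (H2 ltac:(lia))|].
  2: { intros k; unfold v; rewrite Cmod_mult, Cmod_pow, Hz; lra. }
  assert (H3 := HN' n ltac:(lia)); assert (H4 := HN' m ltac:(lia)).
  apply Rabs_def2 in H3; apply Rabs_def2 in H4.
  set (X := sum_n _ n) in *; set (Y := sum_n (fun k => a k * z ^ k)%C m) in *.
  replace X with (w + (- (w - Y) + - (Y - X)))%C by Cring.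
  assert (T1 := Cmod_triangle w (- (w - Y) + - (Y - X))).
  assert (T2 := Cmod_triangle (- (w - Y)) (- (Y - X))).
  rewrite !Cmod_opp in T2.
  lra.
Qed.

Lemma sum_n_le_sum_n (u v : nat -> R) (N : nat) :
  (forall n, (n <= N)%nat -> u n <= v n) -> sum_n u N <= sum_n v N.
Proof. intros H; rewrite !sum_n_Reals; now apply sum_Rle. Qed.

(** The domination is averaged over finitely many equally spaced points of the circle of radius [s],
    with [d] truncated, so that Parseval becomes a finite identity on both sides up to an error
    [eta]. *)
Lemma coef_sqr_sum_le_radius (d e : nat -> C) (K M : nat) (s : R) :
  analytic_in_disk d ->
  (forall z w, Cmod z < 1 -> is_series (fun n => d n * z ^ n)%C w ->
     Cmod w <= Cmod (sum_n (fun n => e n * z ^ n)%C K)) ->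
  0 <= s < 1 ->
  sum_n (fun n => Cmod (d n) ^ 2 * (s ^ n) ^ 2) M <= sum_n (fun n => Cmod (e n) ^ 2) K.
Proof.
  intros Hd Hle Hs.
  set (E := sum_n (fun n => Cmod (e n) ^ 2) K).
  assert (HE : 0 <= E) by (apply sum_n_nonneg; intros n; apply pow2_ge_0).
  apply le_epsilon; intros eta Heta.
  (* For [eps <= 1], [(h + eps)^2 <= (1 + eps) h^2 + 2 eps]. After averaging, the excess over [E] is
     at most [eps (E + 2) <= eta]. *)
  set (eps := Rmin 1 (eta / (E + 2))).
  assert (Heps : 0 < eps <= 1).
  { unfold eps; split; [|apply Rmin_l].
    apply Rmin_pos; [lra|apply Rdiv_lt_0_compat; lra]. }
  assert (Heps2 : eps * (E + 2) <= eta).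
  { replace eta with (eta / (E + 2) * (E + 2)) by (field; lra).
    apply Rmult_le_compat_r; [lra|apply Rmin_r]. }
  destruct (partial_sum_uniform d s eps Hd Hs (proj1 Heps)) as [N0 HN].
  (* [N0] makes the truncation accurate, [K] makes Parseval exact for [e], and [M] puts the wanted
     coefficients inside the truncation. *)
  set (q := Nat.max N0 (Nat.max K M)).
  set (P := fun j => sum_n (fun n => (d n * RtoC (s ^ n)) * (root_of_unity q ^ j) ^ n)%C q).
  set (H := fun j => sum_n (fun n => (e n * RtoC (s ^ n)) * (root_of_unity q ^ j) ^ n)%C K).
  assert (HPH : forall j, Cmod (P j) ^ 2 <= (1 + eps) * Cmod (H j) ^ 2 + 2 * eps).
  { intros j; set (z := (RtoC s * root_of_unity q ^ j)%C).
    assert (Hz : Cmod z = s).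
    { unfold z; rewrite Cmod_mult, Cmod_pow, Cmod_R, Rabs_pos_eq by lra.
      rewrite root_of_unity_Cmod, pow1; ring. }
    destruct (Hd z) as [w Hw]; [lra|].
    specialize (HN q z w ltac:(lia) Hz Hw).
    specialize (Hle z w ltac:(lra) Hw).
    assert (Hpow : forall (b : nat -> C) n, (b n * z ^ n)%C
       = ((b n * RtoC (s ^ n)) * (root_of_unity q ^ j) ^ n)%C).
    { intros b n; unfold z; rewrite Cpow_mult_l, RtoC_pow; ring. }
    rewrite (sum_n_ext _ _ q (Hpow d)) in HN; fold (P j) in HN.
    rewrite (sum_n_ext _ _ K (Hpow e)) in Hle; fold (H j) in Hle.
    assert (0 <= Cmod (P j)) by apply Cmod_ge_0.
    assert (Hb : Cmod (P j) <= Cmod (H j) + eps)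
      by (eapply Rle_trans; [exact HN|]; lra).
    assert (0 <= eps * (Cmod (H j) - 1) ^ 2)
      by (apply Rmult_le_pos; [lra|apply pow2_ge_0]).
    assert (Cmod (P j) ^ 2 <= (Cmod (H j) + eps) ^ 2) by (apply pow_incr; lra).
    nra. }
  assert (Hsum := sum_n_le_sum_n _ (fun j => plus ((1 + eps) * Cmod (H j) ^ 2) (2 * eps))
                    q (fun j _ => HPH j)).
  rewrite sum_n_plus, (sum_n_mult_l (K := R_Ring)), sum_n_const in Hsum.
  unfold P, H in Hsum; rewrite !parseval_root_of_unity in Hsum by lia.
  change plus with Rplus in Hsum; change mult with Rmult in Hsum.
  assert (Hq : 0 < INR (S q)) by (apply lt_0_INR; lia).
  assert (Hsq : forall b : nat -> C, forall n,
    Cmod (b n * RtoC (s ^ n)) ^ 2 = Cmod (b n) ^ 2 * (s ^ n) ^ 2).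
  { intros b n; rewrite Cmod_mult, Cmod_R, Rpow_mult_distr, pow2_abs; reflexivity. }
  rewrite (sum_n_ext _ _ _ (Hsq d)), (sum_n_ext _ _ _ (Hsq e)) in Hsum.
  assert (Hmono : sum_n (fun n => Cmod (d n) ^ 2 * (s ^ n) ^ 2) M
     <= sum_n (fun n => Cmod (d n) ^ 2 * (s ^ n) ^ 2) q).
  { apply sum_n_nonneg_mono; [|lia].
    intros n; apply Rmult_le_pos; apply pow2_ge_0. }
  assert (HEs : sum_n (fun n => Cmod (e n) ^ 2 * (s ^ n) ^ 2) K <= E).
  { apply sum_n_le_sum_n; intros n _.
    rewrite <- (Rmult_1_r (Cmod (e n) ^ 2)) at 2.
    apply Rmult_le_compat_l; [apply pow2_ge_0|].
    assert (0 <= s ^ n) by (apply pow_le; lra).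
    assert (s ^ n <= 1) by (rewrite <- (pow1 n); apply pow_incr; lra).
    nra. }
  set (D := sum_n (fun n => Cmod (d n) ^ 2 * (s ^ n) ^ 2) q) in *.
  set (Es := sum_n (fun n => Cmod (e n) ^ 2 * (s ^ n) ^ 2) K) in *.
  assert (HD : D <= (1 + eps) * Es + 2 * eps).
  { apply (Rmult_le_reg_l (INR (S q))); [exact Hq|].
    eapply Rle_trans; [exact Hsum|]; right; ring. }
  assert ((1 + eps) * Es <= (1 + eps) * E) by (apply Rmult_le_compat_l; lra).
  assert (Hgoal : D <= E + eta) by nra.
  eapply Rle_trans; [exact Hmono|exact Hgoal].
Qed.

(** The left sum at radius [s] is finite, hence continuous in [s], and [s] tends to 1 along
    [1 - 1 / (k + 1)]. *)
Lemma coef_sqr_sum_le (d e : nat -> C) (K M : nat) :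
  analytic_in_disk d ->
  (forall z w, Cmod z < 1 -> is_series (fun n => d n * z ^ n)%C w ->
     Cmod w <= Cmod (sum_n (fun n => e n * z ^ n)%C K)) ->
  sum_n (fun n => Cmod (d n) ^ 2) M <= sum_n (fun n => Cmod (e n) ^ 2) K.
Proof.
  intros Hd Hle.
  set (s := fun k => 1 - / (INR k + 1)).
  assert (Hs : forall k, 0 <= s k < 1).
  { intros k; unfold s; assert (0 <= INR k) by apply pos_INR.
    assert (0 < / (INR k + 1)) by (apply Rinv_0_lt_compat; lra).
    assert (/ (INR k + 1) <= / 1) by (apply Rinv_le_contravar; lra).
    lra. }
  assert (Hlim : is_lim_seq s 1).
  { replace 1 with (1 - 0) by ring; apply is_lim_seq_minus'.
    - apply is_lim_seq_const.
    - apply (is_lim_seq_ext (fun k => / INR (S k))).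
      { intros k; now rewrite S_INR. }
      apply (is_lim_seq_incr_1 (fun k => / INR k)).
      replace (Finite 0) with (Rbar_inv p_infty) by reflexivity.
      apply is_lim_seq_inv; [apply is_lim_seq_INR|discriminate]. }
  assert (Hl : is_lim_seq (fun k => sum_n (fun n => Cmod (d n) ^ 2 * (s k ^ n) ^ 2) M)
                 (sum_n (fun n => Cmod (d n) ^ 2) M)).
  { assert (Ht : forall n, is_lim_seq (fun k => Cmod (d n) ^ 2 * (s k ^ n) ^ 2)
                             (Cmod (d n) ^ 2)).
    { intros n.
      assert (Hc := is_lim_seq_continuous (fun x => Cmod (d n) ^ 2 * (x ^ n) ^ 2) s 1).
      cbv beta in Hc; rewrite !pow1, Rmult_1_r in Hc; apply Hc; [|exact Hlim].
      apply derivable_continuous_pt; apply ex_derive_Reals_0; auto_derive; auto. }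
    induction M as [|M IH].
    - rewrite sum_O; eapply is_lim_seq_ext; [|apply (Ht 0%nat)].
      intros k; now rewrite sum_O.
    - rewrite sum_Sn; eapply is_lim_seq_ext;
        [|apply is_lim_seq_plus'; [apply IH|apply (Ht (S M))]].
      intros k; now rewrite sum_Sn. }
  assert (H := is_lim_seq_le _ _ _ (Finite (sum_n (fun n => Cmod (e n) ^ 2) K))
    (fun k => coef_sqr_sum_le_radius d e K M (s k) Hd Hle (Hs k)) Hl).
  apply H, is_lim_seq_const.
Qed.

(** * Coefficient inequality for bounded functions *)

Lemma is_series_C_unique (u : nat -> C) (w1 w2 : C) :
  is_series u w1 -> is_series u w2 -> w1 = w2.
Proof.
  intros H1 H2.
  exact (filterlim_locally_unique (V := C_NormedModule) (sum_n u) w1 w2 H1 H2).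
Qed.

Lemma is_pseries_C (a : nat -> C) (z w : C) :
  is_pseries (K := C_AbsRing) (V := C_NormedModule) a z w
  <-> is_series (fun n => a n * z ^ n)%C w.
Proof.
  unfold is_pseries; split; apply is_series_ext; intros n;
    change (@pow_n C_AbsRing z n) with (z ^ n)%C; change scal with Cmult; Cring.
Qed.

Lemma is_series_mul_one_plus_monomial (a : nat -> C) (c z w : C) (m : nat) :
  is_series (fun n => a n * z ^ n)%C w ->
  is_series (fun n => (a n + c * @PS_incr_n C_AbsRing C_NormedModule a m n) * z ^ n)%C
    ((1 + c * z ^ m) * w)%C.
Proof.
  intros H.
  assert (H1 := proj1 (is_pseries_C _ _ _)
                  (is_pseries_incr_n _ m _ _ (proj2 (is_pseries_C a z w) H))).
  change (@pow_n C_AbsRing z m) with (z ^ m)%C in H1.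
  assert (H2 := is_series_plus _ _ _ _ H (is_series_scal c _ _ H1)).
  replace ((1 + c * z ^ m) * w)%C with (plus w (scal c (scal (z ^ m)%C w))).
  - revert H2; apply is_series_ext; intros n.
    change plus with Cplus; change scal with Cmult; Cring.
  - change plus with Cplus; change scal with Cmult; Cring.
Qed.

Lemma power_series_coef_unique (a b : nat -> C) :
  (forall z, Cmod z < 1 -> exists w, is_series (fun n => a n * z ^ n)%C w
                                  /\ is_series (fun n => b n * z ^ n)%C w) ->
  forall n, a n = b n.
Proof.
  intros H n; set (d := fun n => (a n - b n)%C).
  assert (Hd : forall z, Cmod z < 1 -> is_series (fun n => d n * z ^ n)%C (RtoC 0)).
  { intros z Hz; destruct (H z Hz) as [w [Ha Hb]].
    assert (H1 := is_series_minus _ _ _ _ Ha Hb).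
    change (opp w) with (- w)%C in H1; change (plus w (- w)%C) with (w - w)%C in H1.
    replace (w - w)%C with (RtoC 0) in H1 by ring.
    revert H1; apply is_series_ext; intros k; unfold d.
    change plus with Cplus; change opp with Copp; Cring. }
  (* The difference series is dominated by the zero polynomial, so its squared coefficients sum to
     at most 0. *)
  assert (Hs : sum_n (fun n => Cmod (d n) ^ 2) n
                <= sum_n (fun n => Cmod ((fun _ => RtoC 0) n) ^ 2) 0).
  { apply coef_sqr_sum_le.
    - intros z Hz; exists (RtoC 0); now apply Hd.
    - intros z w Hz Hw; rewrite (is_series_C_unique _ _ _ Hw (Hd z Hz)), Cmod_0.
      apply Cmod_ge_0. }
  rewrite sum_O, Cmod_0 in Hs.
  assert (H0 : Cmod (d n) ^ 2 <= 0).
  { apply Rle_trans with (sum_n (fun n => Cmod (d n) ^ 2) n); [|lra].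
    destruct n as [|n]; [rewrite sum_O; lra|].
    rewrite sum_Sn; change plus with Rplus.
    assert (0 <= sum_n (fun n => Cmod (d n) ^ 2) n)
      by (apply sum_n_nonneg; intros k; apply pow2_ge_0).
    lra. }
  assert (Hz : Cmod (d n) = 0) by (assert (K := Cmod_ge_0 (d n)); nra).
  apply Cmod_eq_0 in Hz; unfold d in Hz.
  replace (a n) with ((a n - b n) + b n)%C by ring; rewrite Hz; ring.
Qed.

Lemma sum_n_first_last {G : AbelianMonoid} (u : nat -> G) (m : nat) :
  (forall k, (0 < k <= m)%nat -> u k = zero) ->
  sum_n u (S m) = plus (u 0%nat) (u (S m)).
Proof.
  intros H; rewrite sum_Sn; f_equal.
  induction m as [|m IH]; [apply sum_O|].
  rewrite sum_Sn, (H (S m)), plus_zero_r by lia.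
  apply IH; intros k Hk; apply H; lia.
Qed.

(* Parseval for [f (z) (1 + c z^m)], dominated on the disk by [1 + c z^m]. *)
Lemma bounded_coef_test (a : nat -> C) (c : C) (m : nat) :
  analytic_in_disk a -> bounded_by_one_in_disk a -> a 0%nat = 0%C ->
  sum_n (fun k => Cmod (a k) ^ 2) (S m)
    + Cmod (a (S (S m)) + c * a 1%nat) ^ 2 <= 1 + Cmod c ^ 2.
Proof.
  intros Ha Hb H0.
  set (d := fun n => (a n + c * @PS_incr_n C_AbsRing C_NormedModule a (S m) n)%C).
  (* [e] holds the coefficients of [1 + c z^(m+1)]; the exponent [S m] is positive, so the two terms
     never collide. *)
  set (e := fun n => if Nat.eqb n 0 then RtoC 1 else if Nat.eqb n (S m) then c else RtoC 0).
  assert (He0 : e 0%nat = RtoC 1) by reflexivity.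
  assert (Hem : e (S m) = c) by (unfold e; simpl; now rewrite Nat.eqb_refl).
  assert (Hez : forall k, (0 < k <= m)%nat -> e k = RtoC 0).
  { intros k Hk; unfold e.
    rewrite (proj2 (Nat.eqb_neq k 0)), (proj2 (Nat.eqb_neq k (S m))) by lia.
    reflexivity. }
  assert (H := coef_sqr_sum_le d e (S m) (S (S m))).
  lapply H; clear H; [intros H; lapply H; clear H|].
  - rewrite (sum_n_first_last (fun n => Cmod (e n) ^ 2)).
    2: { intros k Hk; rewrite Hez, Cmod_0 by exact Hk; change zero with 0; Rring. }
    rewrite He0, Hem, Cmod_1, sum_Sn; change plus with Rplus.
    rewrite (sum_n_ext_loc (fun n => Cmod (d n) ^ 2) (fun n => Cmod (a n) ^ 2)).
    + unfold d at 1; rewrite PS_incr_n_simplify.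
      destruct (le_lt_dec (S m) (S (S m))) as [_|K]; [|lia].
      replace (S (S m) - S m)%nat with 1%nat by lia; intros H; lra.
    + intros k Hk; unfold d; rewrite PS_incr_n_simplify.
      destruct (le_lt_dec (S m) k) as [K|K].
      (* Up to index [m + 1] the shifted copy contributes at most [c * a 0 = 0], so [d] and [a]
         agree there. *)
      * replace (k - S m)%nat with 0%nat by lia; rewrite H0.
        do 2 f_equal; ring.
      * change zero with (RtoC 0); do 2 f_equal; ring.
  - intros z w Hz Hw; destruct (Ha z Hz) as [v Hv].
    assert (Hv' := is_series_mul_one_plus_monomial a c z v (S m) Hv).
    rewrite (is_series_C_unique _ _ _ Hw Hv'), Cmod_mult.
    rewrite (sum_n_first_last (fun n => e n * z ^ n)%C).
    2: { intros k Hk; rewrite Hez by exact Hk; change zero with (RtoC 0); Cring. }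
    rewrite He0, Hem; change plus with Cplus.
    replace (1 * z ^ 0)%C with (RtoC 1) by (simpl; ring).
    rewrite <- (Rmult_1_r (Cmod (1 + c * z ^ S m))) at 2.
    apply Rmult_le_compat_l; [apply Cmod_ge_0|apply (Hb z); assumption].
  - intros z Hz; destruct (Ha z Hz) as [v Hv]; eexists.
    apply (is_series_mul_one_plus_monomial a c z v (S m) Hv).
Qed.

(** This is [bounded_coef_test] with the best [c]: with [B] the top coefficient, the maximum of
    [|B + c a_1|^2 - |c|^2] is [|B|^2 / (1 - A2)]. Multiplying by [1 - A2] also covers [A2 = 1]. *)
Lemma bounded_coef_schur (a : nat -> C) (m : nat) :
  analytic_in_disk a -> bounded_by_one_in_disk a -> a 0%nat = 0%C ->
  let A2 := Cmod (a 1%nat) ^ 2 in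
  A2 <= 1 /\
  (1 - A2) * (sum_n (fun k => Cmod (a k) ^ 2) (S m) - A2) + Cmod (a (S (S m))) ^ 2
    <= (1 - A2) ^ 2.
Proof.
  intros Ha Hb H0 A2.
  set (T := sum_n (fun k => Cmod (a k) ^ 2) (S m)).
  assert (HT : A2 <= T).
  { apply Rle_trans with (sum_n (fun k => Cmod (a k) ^ 2) 1).
    - rewrite sum_Sn, sum_O; change plus with Rplus.
      assert (0 <= Cmod (a 0%nat) ^ 2) by apply pow2_ge_0; unfold A2; lra.
    - apply sum_n_nonneg_mono; [intros; apply pow2_ge_0|lia]. }
  assert (Htest := fun c => bounded_coef_test a c m Ha Hb H0); fold T in Htest.
  set (B := a (S (S m))) in *.
  assert (H1 := Htest 0%C); rewrite Cmod_0, Cmult_0_l, Cplus_0_r in H1.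
  assert (HB : 0 <= Cmod B ^ 2) by apply pow2_ge_0.
  assert (HA : A2 <= 1) by (simpl in *; lra).
  split; [exact HA|].
  (* If [A2 = 1], the case [c = 0] together with [A2 <= T] forces [B = 0]. *)
  destruct (Req_dec A2 1) as [E|E]; [rewrite E in *; simpl in *; nra|].
  (* This [c] cancels the top coefficient of [(1 - conj a_1 g) (1 + c z^m)], [f = z g]. *)
  set (t := / (1 - A2)).
  assert (Ht : (1 - A2) * t = 1) by (unfold t; field; lra).
  specialize (Htest (RtoC t * B * Cconj (a 1%nat))%C).
  replace (B + RtoC t * B * Cconj (a 1%nat) * a 1%nat)%C
    with (RtoC (1 + t * A2) * B)%C in Htest.
  2: { rewrite RtoC_plus, RtoC_mult; unfold A2; rewrite Cmod2_conj; ring. }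
  rewrite !Cmod_mult, Cmod_conj, !Cmod_R, !Rpow_mult_distr, !pow2_abs in Htest.
  fold A2 in Htest.
  replace (1 + t * A2) with t in Htest by lra.
  assert (Htest2 : T + (t ^ 2 * (1 - A2)) * Cmod B ^ 2 <= 1) by lra.
  replace (t ^ 2 * (1 - A2)) with t in Htest2
    by (replace (t ^ 2 * (1 - A2)) with (t * ((1 - A2) * t)) by ring; rewrite Ht; ring).
  apply (Rmult_le_compat_l (1 - A2)) in Htest2; [|lra].
  replace ((1 - A2) * (T + t * Cmod B ^ 2))
    with ((1 - A2) * T + ((1 - A2) * t) * Cmod B ^ 2) in Htest2 by ring.
  rewrite Ht in Htest2; lra.
Qed.

(** * The majorant at the radius *)

Lemma sum_n_S (u : nat -> R) (N : nat) : sum_n u (S N) = sum_n u N + u (S N).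
Proof. now rewrite sum_Sn. Qed.

(* Abel summation: the defects [(1 - A^2)^2 - (1 - A^2) Q_N - b_(N+1)^2] are
   nonnegative, and [rho^N] decreases. *)
Lemma weighted_sqr_sum_le (A rho : R) (b : nat -> R) :
  0 <= A <= 1 -> 0 < rho <= 1 ->
  b 0%nat ^ 2 <= (1 - A ^ 2) ^ 2 ->
  (forall N, (1 - A ^ 2) * sum_n (fun k => b k ^ 2) N + b (S N) ^ 2 <= (1 - A ^ 2) ^ 2) ->
  forall N, (1 - A ^ 2 * rho) * sum_n (fun k => b k ^ 2 * rho ^ k) N <= (1 - A ^ 2) ^ 2.
Proof.
  intros HA Hr Hb0 Hb N.
  set (Q := sum_n (fun k => b k ^ 2)) in *.
  set (W := sum_n (fun k => b k ^ 2 * rho ^ k)).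
  assert (Hclaim : W (S N) - A ^ 2 * rho * W N
     <= (1 - A ^ 2) ^ 2 - rho ^ S N * ((1 - A ^ 2) ^ 2 - (1 - A ^ 2) * Q N - b (S N) ^ 2)).
  { induction N as [|N IH].
    - unfold W, Q; rewrite sum_n_S, !sum_O; simpl (rho ^ 0); simpl (rho ^ 1).
      assert (0 <= (1 - rho) * ((1 - A ^ 2) ^ 2 - b 0%nat ^ 2))
        by (apply Rmult_le_pos; lra).
      lra.
    - unfold W at 1; rewrite sum_n_S; fold W.
      replace (W (S N)) with (W N + b (S N) ^ 2 * rho ^ S N) at 2
        by (unfold W, Q; now rewrite sum_n_S).
      replace (Q (S N)) with (Q N + b (S N) ^ 2) by (unfold W, Q; now rewrite sum_n_S).
      assert (H : 0 <= rho ^ S N * ((1 - rho)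
                 * ((1 - A ^ 2) ^ 2 - (1 - A ^ 2) * Q N - b (S N) ^ 2))).
      { apply Rmult_le_pos; [apply pow_le; lra|].
        apply Rmult_le_pos; [lra|]; specialize (Hb N); lra. }
      change (rho ^ S (S N)) with (rho * rho ^ S N).
      set (P := rho ^ S N) in *; lra. }
  assert (0 <= rho ^ S N * ((1 - A ^ 2) ^ 2 - (1 - A ^ 2) * Q N - b (S N) ^ 2)).
  { apply Rmult_le_pos; [apply pow_le; lra|]; specialize (Hb N); lra. }
  (* Monotonicity bounds [(1 - A^2 rho) W_N] by the left side of the claim. *)
  assert (W N <= W (S N)).
  { apply sum_n_nonneg_mono; [|lia].
    intros k; apply Rmult_le_pos; [apply pow2_ge_0|apply pow_le; lra]. }
  lra.
Qed.

Lemma geometric_sum_le (g : R) (N : nat) :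
  0 <= g < 1 -> sum_n (fun k => g ^ k) N <= / (1 - g).
Proof.
  intros Hg; rewrite sum_n_Reals, tech3 by lra.
  unfold Rdiv; rewrite <- (Rmult_1_l (/ (1 - g))) at 2.
  apply Rmult_le_compat_r; [left; apply Rinv_0_lt_compat; lra|].
  assert (0 <= g ^ S N) by (apply pow_le; lra); lra.
Qed.

(** Termwise AM-GM for the factorisation [x^(2k) = rho^k g^k]; the free weight [lam] is chosen later
    to balance the two halves. *)
Lemma amgm_sum_le (b : nat -> R) (lam rho g x : R) (N : nat) :
  0 < lam -> 0 < rho -> x ^ 2 = rho * g ->
  sum_n (fun k => b k * x ^ k) N
    <= (lam * sum_n (fun k => b k ^ 2 * rho ^ k) N + sum_n (fun k => g ^ k) N / lam) / 2.
Proof.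
  intros Hl Hr Hx.
  assert (Hk : forall k, b k * x ^ k <= (lam * (b k ^ 2 * rho ^ k) + g ^ k / lam) / 2).
  { intros k; assert (HR : 0 < rho ^ k) by (apply pow_lt; lra).
    assert (HX : (x ^ k) ^ 2 = rho ^ k * g ^ k).
    { rewrite <- Rpow_mult_distr, <- Hx, <- !pow_mult; f_equal; lia. }
    assert (E : (lam * (b k ^ 2 * rho ^ k) + g ^ k / lam) / 2 - b k * x ^ k
       = (lam * rho ^ k * b k - x ^ k) ^ 2 / (2 * lam * rho ^ k)).
    { replace (g ^ k) with ((x ^ k) ^ 2 / rho ^ k) by (rewrite HX; field; lra).
      field; lra. }
    assert (0 <= (lam * rho ^ k * b k - x ^ k) ^ 2 / (2 * lam * rho ^ k)).
    { apply Rdiv_le_0_compat; [apply pow2_ge_0|].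
      apply Rmult_lt_0_compat; lra. }
    lra. }
  induction N as [|N IH].
  - rewrite !sum_O; apply Hk.
  - rewrite !sum_n_S; specialize (Hk (S N)); unfold Rdiv in *; lra.
Qed.

Lemma Rle_div_of_mul_le (u v w : R) : 0 < u -> u * v <= w -> v <= w / u.
Proof.
  intros Hu H; apply (Rmult_le_reg_l u); [exact Hu|].
  replace (u * (w / u)) with w by (field; lra); exact H.
Qed.

(** Here [b k] stands for [|a_(p(k+1)+1)|], whence the extra factor [x] before the sum. As
    [r y = x], the conclusion is the bound by 1 for the majorant at [r], multiplied by [y]. *)
Lemma schur_sum_le (A x y : R) (b : nat -> R) :
  0 <= A <= 1 -> 0 < x < 1 -> 2 * x ^ 2 <= 1 ->
  (forall u, (3 - y) * u <= 2 * u ^ 2 + (1 - x ^ 2)) ->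
  b 0%nat ^ 2 <= (1 - A ^ 2) ^ 2 ->
  (forall N, (1 - A ^ 2) * sum_n (fun k => b k ^ 2) N + b (S N) ^ 2 <= (1 - A ^ 2) ^ 2) ->
  forall N, x * (A + x * sum_n (fun k => b k * x ^ k) N) <= y.
Proof.
  intros HA Hx Hx2 Hy Hb0 Hb N.
  set (V := sum_n (fun k => b k * x ^ k) N).
  destruct (Req_dec A 1) as [E|HA1].
  { assert (Hz : forall k, b k = 0).
    { intros [|k]; [|specialize (Hb k)]; rewrite E in *; nra. }
    assert (HV : V = 0).
    { apply (sum_n_zero (G := R_AbelianMonoid)); intros k _; rewrite Hz; apply Rmult_0_l. }
    (* Dividing the quadratic inequality at [u = 1 - x] by [1 - x] gives [x <= y]. *)
    rewrite HV, E; specialize (Hy (1 - x)); nra. }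
  assert (HA2 : 0 < 1 - A ^ 2) by nra.
  destruct (Rle_lt_dec x A) as [HxA|HxA].
  - assert (HAx : 0 < 1 - A * x) by nra.
    assert (Hrho : 0 < x / A <= 1).
    { split; [apply Rdiv_lt_0_compat; lra|apply Rle_div_l; lra]. }
    assert (HW := weighted_sqr_sum_le A (x / A) b HA Hrho Hb0 Hb N).
    replace (1 - A ^ 2 * (x / A)) with (1 - A * x) in HW by (field; lra).
    apply Rle_div_of_mul_le in HW; [|exact HAx].
    assert (HG := geometric_sum_le (A * x) N ltac:(nra)).
    (* This weight makes both halves at most [(1 - A^2) / (1 - A x)]. *)
    assert (HV := amgm_sum_le b (/ (1 - A ^ 2)) (x / A) (A * x) x N
      (Rinv_0_lt_compat _ HA2) (proj1 Hrho) ltac:(field; lra)).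
    fold V in HV.
    set (W := sum_n (fun k => b k ^ 2 * (x / A) ^ k) N) in *.
    set (G := sum_n (fun k => (A * x) ^ k) N) in *.
    assert (HV2 : V <= (1 - A ^ 2) / (1 - A * x)).
    { apply (Rmult_le_compat_l (/ (1 - A ^ 2))) in HW;
        [|left; apply Rinv_0_lt_compat; lra].
      apply (Rmult_le_compat_l (1 - A ^ 2)) in HG; [|lra].
      replace (/ (1 - A ^ 2) * ((1 - A ^ 2) ^ 2 / (1 - A * x)))
        with ((1 - A ^ 2) / (1 - A * x)) in HW by (field; lra).
      replace (G / / (1 - A ^ 2)) with ((1 - A ^ 2) * G) in HV by (field; lra).
      unfold Rdiv in *; lra. }
    apply Rle_trans with (x * (A + x * ((1 - A ^ 2) / (1 - A * x)))).
    { apply Rmult_le_compat_l; [lra|]; apply Rplus_le_compat_l.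
      apply Rmult_le_compat_l; lra. }
    replace (x * (A + x * ((1 - A ^ 2) / (1 - A * x))))
      with ((x * A * (1 - A * x) + x ^ 2 * (1 - A ^ 2)) / (1 - A * x)) by (field; lra).
    apply Rle_div_l; [exact HAx|].
    specialize (Hy (1 - A * x)); lra.
  - assert (Hx1 : 0 < 1 - x ^ 2) by lra.
    assert (HW := weighted_sqr_sum_le A 1 b HA ltac:(lra) Hb0 Hb N).
    rewrite Rmult_1_r in HW.
    apply Rle_div_of_mul_le in HW; [|exact HA2].
    replace ((1 - A ^ 2) ^ 2 / (1 - A ^ 2)) with (1 - A ^ 2) in HW by (field; lra).
    assert (HG := geometric_sum_le (x ^ 2) N ltac:(nra)).
    (* The weight is the balanced one for [A = x], the end of this range. *)
    assert (HV := amgm_sum_le b (/ (1 - x ^ 2)) 1 (x ^ 2) x N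
      (Rinv_0_lt_compat _ Hx1) Rlt_0_1 ltac:(ring)).
    fold V in HV.
    set (W := sum_n (fun k => b k ^ 2 * 1 ^ k) N) in *.
    set (G := sum_n (fun k => (x ^ 2) ^ k) N) in *.
    assert (HV2 : V <= ((1 - A ^ 2) / (1 - x ^ 2) + 1) / 2).
    { apply (Rmult_le_compat_l (/ (1 - x ^ 2))) in HW;
        [|left; apply Rinv_0_lt_compat; lra].
      apply (Rmult_le_compat_l (1 - x ^ 2)) in HG; [|lra].
      rewrite Rinv_r in HG by lra.
      replace (G / / (1 - x ^ 2)) with ((1 - x ^ 2) * G) in HV by (field; lra).
      unfold Rdiv in *; lra. }
    assert (HV3 : A + x * V <= 2 * x).
    { apply Rle_trans with (A + x * (((1 - A ^ 2) / (1 - x ^ 2) + 1) / 2)).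
      { apply Rplus_le_compat_l, Rmult_le_compat_l; lra. }
      (* The second factor is nonnegative: [x (A + x) <= 2 x^2 <= 2 (1 - x^2)] because
         [2 x^2 <= 1]. *)
      assert (E : 2 * x - (A + x * (((1 - A ^ 2) / (1 - x ^ 2) + 1) / 2))
        = (x - A) * (2 * (1 - x ^ 2) - x * (A + x)) / (2 * (1 - x ^ 2)))
        by (field; lra).
      assert (0 <= (x - A) * (2 * (1 - x ^ 2) - x * (A + x)) / (2 * (1 - x ^ 2))).
      { apply Rdiv_le_0_compat; [|lra]; apply Rmult_le_pos; nra. }
      lra. }
    assert (Hyx : 2 * x ^ 2 <= y).
    (* The quadratic inequality at [u = 1 - x^2], divided by [1 - x^2]. *)
    { specialize (Hy (1 - x ^ 2)); nra. }
    nra.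
Qed.

(** The polynomial equals [(3 - y)^2 - 8 (1 - x^2)], and [y <= 1] then gives [2 x^2 <= 1].
    Maximality of the root enters only in [1 / 3 < x]: otherwise a sign change beyond [r] would
    produce a larger root. *)
Lemma is_rp_facts (p : nat) (r : R) :
  (1 <= p)%nat -> is_rp p r ->
  let x := r ^ p in let y := r ^ (p - 1) in
  x = r * y /\ 0 < y <= 1 /\ 1 / 3 < x < 1 /\ 2 * x ^ 2 <= 1
  /\ (3 - y) ^ 2 = 8 * (1 - x ^ 2).
Proof.
  intros Hp [Hr [Hroot Hmax]] x y.
  assert (Hpoly : forall s, rp_poly p s
     = - 6 * s ^ (p - 1) + (s ^ (p - 1)) ^ 2 + 8 * (s * s ^ (p - 1)) ^ 2 + 1).
  { intros s; unfold rp_poly; rewrite tech_pow_Rmult, <- !pow_mult.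
    replace (S (p - 1)) with p by lia.
    now rewrite (Nat.mul_comm p), (Nat.mul_comm (p - 1)). }
  assert (Hs : forall s, s ^ p = s * s ^ (p - 1)).
  { intros s; rewrite tech_pow_Rmult; f_equal; lia. }
  assert (Hxy : x = r * y) by apply Hs.
  assert (Hy0 : forall s, 0 < s <= 1 -> 0 < s ^ (p - 1) <= 1).
  { intros s H; split; [apply pow_lt; lra|].
    rewrite <- (pow1 (p - 1)); apply pow_incr; lra. }
  assert (Hy : 0 < y <= 1) by (apply Hy0; lra).
  rewrite Hpoly in Hroot; fold y in Hroot; rewrite <- Hxy in Hroot.
  assert (Hx0 : 0 < x < 1) by (rewrite Hxy; nra).
  split; [exact Hxy|]; split; [exact Hy|].
  assert (Hx2 : 2 * x ^ 2 <= 1) by nra.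
  split; [split; [|lra]|split; [exact Hx2|lra]].
  apply Rnot_le_lt; intros Hx3.
  set (t := Rpower (1 / 3) (/ INR p)).
  assert (Ht0 : 0 < t) by apply exp_pos.
  assert (Htp : t ^ p = 1 / 3).
  { rewrite <- Rpower_pow by exact Ht0; unfold t.
    rewrite Rpower_mult, Rinv_l, Rpower_1; [reflexivity|lra|].
    apply not_0_INR; lia. }
  assert (Ht1 : t < 1).
  { apply Rnot_le_lt; intros H; apply (pow_R1_Rle t p) in H; lra. }
  assert (Hrt : r <= t).
  { apply Rnot_lt_le; intros H.
    assert (t ^ (p - 1) <= y) by (apply pow_incr; lra).
    assert (0 < t ^ (p - 1)) by (apply pow_lt; lra).
    rewrite Hs in Htp; nra. }
  (* With [v = t^(p-1)] and [t^p = 1/3] the value is [v^2 - 6 v + 17/9], which is zero at [v = 1/3]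
     and negative for [1/3 < v <= 1]. *)
  assert (Hneg : rp_poly p t < 0).
  { rewrite Hpoly, <- Hs, Htp.
    assert (H := Hy0 t ltac:(lra)); rewrite Hs in Htp; nra. }
  destruct (IVT (rp_poly p) t 1) as [s [Hst Hs0]].
  - intros s; apply derivable_continuous_pt, ex_derive_Reals_0.
    unfold rp_poly; auto_derive; auto.
  - exact Ht1.
  - exact Hneg.
  - rewrite Hpoly, pow1; lra.
  - assert (s <> t) by (intros ->; lra).
    assert (s <> 1) by (intros ->; rewrite Hpoly, pow1 in Hs0; lra).
    assert (s <= r) by (apply Hmax; [lra|exact Hs0]).
    lra.
Qed.

Lemma sum_n_arithmetic_progression (p : nat) (u : nat -> R) (K : nat) :
  (1 <= p)%nat -> (forall n, (forall k, n <> (p * k + 1)%nat) -> u n = 0) ->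
  sum_n u (p * K + 1) = sum_n (fun k => u (p * k + 1)%nat) K.
Proof.
  intros Hp Hu.
  assert (Hgap : forall m j, (j < p)%nat -> sum_n u (p * m + 1 + j) = sum_n u (p * m + 1)).
  { intros m j; induction j as [|j IH]; intros Hj; [now rewrite Nat.add_0_r|].
    rewrite Nat.add_succ_r, sum_n_S, IH, Hu by (lia || (intros k; destruct (le_lt_dec k m); nia)).
    apply Rplus_0_r. }
  induction K as [|K IH].
  - rewrite sum_O, Nat.mul_0_r; change (0 + 1)%nat with 1%nat.
    rewrite sum_n_S, sum_O, (Hu 0%nat) by (intros; lia).
    apply Rplus_0_l.
  - rewrite sum_n_S, <- IH.
    replace (p * S K + 1)%nat with (S (p * K + 1 + (p - 1))) by lia.
    now rewrite sum_n_S, Hgap by lia.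
Qed.

Lemma sum_n_split_first (u : nat -> R) (N : nat) :
  sum_n u (S N) = u 0%nat + sum_n (fun k => u (S k)) N.
Proof.
  induction N as [|N IH]; [now rewrite sum_n_S, !sum_O|].
  rewrite sum_n_S, IH, sum_n_S; Rring.
Qed.

Lemma bohr_majorant_le_1 (p : nat) (rp : R) (a : nat -> C) :
  (1 <= p)%nat -> is_rp p rp ->
  analytic_in_disk a -> p_symmetric p a -> bounded_by_one_in_disk a ->
  bohr_majorant a rp <= 1.
Proof.
  intros Hp Hrp Ha Hsym Hb.
  destruct (is_rp_facts p rp Hp Hrp) as [Hxy [Hy [Hx [Hx2 Hdisc]]]].
  destruct Hrp as [Hr _].
  set (x := rp ^ p) in *; set (y := rp ^ (p - 1)) in *.
  set (A := Cmod (a 1%nat)).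
  set (b := fun k => Cmod (a (p * S k + 1)%nat)).
  assert (H0 : a 0%nat = 0%C) by (apply Hsym; intros; lia).
  assert (HA : 0 <= A <= 1).
  { destruct (bounded_coef_schur a 0 Ha Hb H0) as [H _].
    assert (0 <= A) by apply Cmod_ge_0; fold A in H; nra. }
  assert (Hschur : forall N, (1 - A ^ 2) * (sum_n (fun k => Cmod (a (p * k + 1)%nat) ^ 2) N
                                  - A ^ 2) + b N ^ 2 <= (1 - A ^ 2) ^ 2).
  (* Chosen so that [S (S m)] is the index [p (N + 1) + 1] of [b N]. *)
  { intros N; set (m := (p * S N - 1)%nat).
    destruct (bounded_coef_schur a m Ha Hb H0) as [_ H]; fold A in H.
    replace (S (S m)) with (p * S N + 1)%nat in H by (unfold m; nia); fold (b N) in H.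
    rewrite <- (sum_n_arithmetic_progression p (fun n => Cmod (a n) ^ 2)).
    2: exact Hp.
    2: { intros n Hn; rewrite (Hsym n Hn), Cmod_0; ring. }
    assert (Hm : sum_n (fun k => Cmod (a k) ^ 2) (p * N + 1)
             <= sum_n (fun k => Cmod (a k) ^ 2) (S m)).
    { apply sum_n_nonneg_mono; [intros; apply pow2_ge_0|unfold m; nia]. }
    assert (0 <= 1 - A ^ 2) by nra; nra. }
  assert (Hbound : forall N, x * (A + x * sum_n (fun k => b k * x ^ k) N) <= y).
  { apply schur_sum_le; try assumption; try lra.
    (* The discriminant vanishes, so the quadratic is [(4 u - (3 - y))^2 / 8]. *)
    - intros u; assert (0 <= (4 * u - (3 - y)) ^ 2) by apply pow2_ge_0; nra.
    - specialize (Hschur 0%nat); rewrite sum_O, Nat.mul_0_r in Hschur.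
      simpl Nat.add in Hschur; fold A in Hschur; lra.
    - intros N; specialize (Hschur (S N)).
      rewrite sum_n_split_first, Nat.mul_0_r in Hschur.
      simpl (0 + 1)%nat in Hschur; fold A in Hschur; fold b in Hschur.
      change (fun k => Cmod (a (p * S k + 1)%nat) ^ 2) with (fun k => b k ^ 2) in Hschur.
      lra. }
  assert (Hpart : forall N, sum_n (fun n => Cmod (a n) * rp ^ n) N <= 1).
  { intros N; apply Rle_trans with (sum_n (fun n => Cmod (a n) * rp ^ n) (p * S N + 1)).
    { apply sum_n_nonneg_mono; [|nia].
      intros n; apply Rmult_le_pos; [apply Cmod_ge_0|apply pow_le; lra]. }
    rewrite sum_n_arithmetic_progression.
    2: exact Hp.
    2: { intros n Hn; rewrite (Hsym n Hn), Cmod_0; ring. }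
    rewrite sum_n_split_first, Nat.mul_0_r; simpl (0 + 1)%nat; fold A.
    rewrite (sum_n_ext _ (fun k => rp * x * (b k * x ^ k))).
    2: { intros k; fold (b k); unfold x; rewrite <- pow_mult, pow_add.
         rewrite Nat.mul_succ_r, pow_add; Rring. }
    rewrite (sum_n_mult_l (K := R_Ring)); change mult with Rmult.
    specialize (Hbound N).
    set (V := sum_n (fun k => b k * x ^ k) N) in *.
    apply (Rmult_le_reg_l y); [lra|]; rewrite Hxy in Hbound at 1.
    change (Rmult y (A * rp ^ 1 + rp * x * V) <= y * 1).
    simpl; lra. }
  assert (H := is_lim_seq_le _ (fun _ => 1) (Series (fun n => Cmod (a n) * rp ^ n)) 1 Hpart).
  apply H; [|apply is_lim_seq_const].
  apply Series_correct, analytic_abs_summable; [exact Ha|lra].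
Qed.

(** * The extremal function *)

Lemma is_series_single_term {K : AbsRing} {V : NormedModule K} (u : nat -> V) (i : nat) :
  (forall n, n <> i -> u n = zero) -> is_series u (u i).
Proof.
  intros Hu.
  assert (Hi : sum_n u i = u i).
  { destruct i as [|i]; [apply sum_O|].
    rewrite sum_Sn, sum_n_zero; [apply plus_zero_l|intros n Hn; apply Hu; lia]. }
  apply (filterlim_ext_loc (fun _ => u i)).
  - exists i; intros n; induction 1 as [|n Hn IH]; [now symmetry|].
    now rewrite sum_Sn, <- IH, (Hu (S n)), plus_zero_r by lia.
  - apply filterlim_const.
Qed.

Lemma is_series_two_terms {K : AbsRing} {V : NormedModule K} (u : nat -> V) (i j : nat) :
  i <> j -> (forall n, n <> i -> n <> j -> u n = zero) ->
  is_series u (plus (u i) (u j)).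
Proof.
  intros Hij Hu.
  set (v := fun k n => if Nat.eqb n k then u n else zero).
  assert (Hv : forall k, is_series (v k) (u k)).
  { intros k; replace (u k) with (v k k) by (unfold v; now rewrite Nat.eqb_refl).
    apply is_series_single_term; intros n Hn; unfold v.
    now rewrite (proj2 (Nat.eqb_neq n k) Hn). }
  generalize (is_series_plus _ _ _ _ (Hv i) (Hv j)); apply is_series_ext.
  intros n; unfold v.
  destruct (Nat.eqb_spec n i) as [Ei|Ei]; destruct (Nat.eqb_spec n j) as [Ej|Ej].
  - lia.
  - apply plus_zero_r.
  - apply plus_zero_l.
  - now rewrite (Hu n Ei Ej), plus_zero_l.
Qed.

(** Multiplying by [1 - A z^p] clears the denominator and leaves the polynomial [z^(p+1) - A z],
    whose coefficients are compared. *)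
Lemma extremal_coef_rec (p : nat) (A : R) (c : nat -> C) :
  (1 <= p)%nat -> 0 < A < 1 ->
  (forall z, Cmod z < 1 -> is_series (fun n => c n * z ^ n)%C (extremal_f p A z)) ->
  forall n, (c n + - RtoC A * @PS_incr_n C_AbsRing C_NormedModule c p n)%C
    = (if Nat.eqb n 1 then - RtoC A else if Nat.eqb n (S p) then 1 else 0)%C.
Proof.
  intros Hp HA Hc.
  apply power_series_coef_unique; intros z Hz.
  exists (z * (z ^ p - RtoC A))%C; split.
  - replace (z * (z ^ p - RtoC A))%C
      with ((1 + - RtoC A * z ^ p) * extremal_f p A z)%C.
    + now apply is_series_mul_one_plus_monomial, Hc.
    + unfold extremal_f; field; intros E.
      assert (H : Cmod (RtoC A * z ^ p) = 1).
      { replace (RtoC A * z ^ p)%C with (1 - (1 - RtoC A * z ^ p))%C by ring.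
        rewrite E; replace (1 - 0)%C with (RtoC 1) by ring; apply Cmod_1. }
      rewrite Cmod_mult, Cmod_pow, Cmod_R, Rabs_pos_eq in H by lra.
      assert (Cmod z ^ p <= 1)
        by (rewrite <- (pow1 p); apply pow_incr; split; [apply Cmod_ge_0|lra]).
      assert (0 <= Cmod z ^ p) by apply pow_le, Cmod_ge_0.
      nra.
  - assert (H := is_series_two_terms (K := C_AbsRing) (V := C_NormedModule)
      (fun n => (if Nat.eqb n 1 then - RtoC A else if Nat.eqb n (S p) then 1 else 0)
                  * z ^ n)%C 1 (S p)).
    lapply H; [clear H; intros H|lia].
    lapply H; [clear H; intros H|].
    + cbv beta in H; change plus with Cplus in H.
      rewrite !Nat.eqb_refl in H.
      rewrite (proj2 (Nat.eqb_neq (S p) 1)) in H by lia.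
      replace (z * (z ^ p - RtoC A))%C with (- RtoC A * z ^ 1 + 1 * z ^ S p)%C.
      * exact H.
      * rewrite Cpow_1_r, Cpow_S; ring.
    + intros n H1 H2.
      rewrite (proj2 (Nat.eqb_neq n 1) H1), (proj2 (Nat.eqb_neq n (S p)) H2).
      change zero with (RtoC 0); Cring.
Qed.

(* The coefficients are [c_1 = - A] and [c_(pk+1) = (1 - A^2) A^(k-1)], so the
   recurrence of [extremal_coef_rec] survives in absolute value away from
   [n = p + 1], where the sign of [c_1] costs [2 A^2]. *)
Lemma extremal_Cmod_rec (p : nat) (A : R) (c : nat -> C) :
  (1 <= p)%nat -> 0 < A < 1 ->
  (forall z, Cmod z < 1 -> is_series (fun n => c n * z ^ n)%C (extremal_f p A z)) ->
  forall n, Cmod (c n)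
    = (if Nat.eqb n 1 then A else if Nat.eqb n (S p) then 1 - 2 * A ^ 2 else 0)
      + A * @PS_incr_n R_AbsRing R_NormedModule (fun k => Cmod (c k)) p n.
Proof.
  intros Hp HA Hc.
  assert (Hrec : forall n, c n
    = ((if Nat.eqb n 1 then - RtoC A else if Nat.eqb n (S p) then 1 else 0)
      + RtoC A * @PS_incr_n C_AbsRing C_NormedModule c p n)%C).
  { intros n; rewrite <- (extremal_coef_rec p A c Hp HA Hc n); ring. }
  assert (H0 : c 0%nat = 0%C).
  { rewrite Hrec, PS_incr_n_simplify; simpl.
    destruct (le_lt_dec p 0); [lia|]; change zero with (RtoC 0); ring. }
  assert (H1 : c 1%nat = (- RtoC A)%C).
  { rewrite Hrec, PS_incr_n_simplify; simpl Nat.eqb; cbv iota.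
    destruct (le_lt_dec p 1).
    - replace (1 - p)%nat with 0%nat by lia; rewrite H0; ring.
    - change zero with (RtoC 0); ring. }
  intros n; rewrite PS_incr_n_simplify.
  destruct (Nat.eqb_spec n 1) as [E1|E1]; [|destruct (Nat.eqb_spec n (S p)) as [Ep|Ep]].
  - subst n; rewrite H1, Cmod_opp, Cmod_R, Rabs_pos_eq by lra.
    (* The shifted term reaches index 1 only for [p = 1], where it is [c_0 = 0]. *)
    destruct (le_lt_dec p 1).
    + replace (1 - p)%nat with 0%nat by lia; rewrite H0, Cmod_0; ring.
    + change zero with 0; ring.
  - subst n; rewrite Hrec, PS_incr_n_simplify.
    rewrite (proj2 (Nat.eqb_neq (S p) 1)), Nat.eqb_refl by lia.
    destruct (le_lt_dec p (S p)); [|lia].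
    replace (S p - p)%nat with 1%nat by lia; rewrite H1.
    replace (1 + RtoC A * - RtoC A)%C with (RtoC (1 - A ^ 2)).
    2: { rewrite RtoC_minus, RtoC_pow; ring. }
    rewrite Cmod_opp, !Cmod_R, !Rabs_pos_eq by nra; ring.
  - rewrite Hrec, PS_incr_n_simplify.
    rewrite (proj2 (Nat.eqb_neq n 1) E1), (proj2 (Nat.eqb_neq n (S p)) Ep).
    rewrite Cplus_0_l, Cmod_mult, Cmod_R, Rabs_pos_eq by lra.
    destruct (le_lt_dec p n); [ring|].
    change (@zero C_NormedModule) with (RtoC 0); rewrite Cmod_0.
    change zero with 0; ring.
Qed.

(** Summing the recurrence for the absolute values gives
    [L = A r + (1 - 2 A^2) r^(p+1) + A r^p L]. *)
Lemma extremal_majorant (p : nat) (A r : R) (c : nat -> C) :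
  (1 <= p)%nat -> 0 < A < 1 -> 0 <= r < 1 ->
  (forall z, Cmod z < 1 -> is_series (fun n => c n * z ^ n)%C (extremal_f p A z)) ->
  bohr_majorant c r * (1 - A * r ^ p) = A * r + (1 - 2 * A ^ 2) * (r * r ^ p).
Proof.
  intros Hp HA Hr Hc.
  set (L := bohr_majorant c r).
  assert (HL : is_series (fun n => Cmod (c n) * r ^ n) L).
  { apply Series_correct, analytic_abs_summable; [|exact Hr].
    intros z Hz; eexists; apply Hc, Hz. }
  assert (H1 := proj1 (is_pseries_R _ _ _)
                  (is_pseries_incr_n _ p _ _ (proj2 (is_pseries_R _ r L) HL))).
  rewrite pow_n_pow in H1.
  assert (H2 := is_series_two_terms (K := R_AbsRing) (V := R_NormedModule)
    (fun n => (if Nat.eqb n 1 then A else if Nat.eqb n (S p) then 1 - 2 * A ^ 2 else 0)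
                * r ^ n) 1 (S p)).
  lapply H2; [clear H2; intros H2|lia].
  lapply H2; [clear H2; intros H2|].
  2: { intros n E1 E2.
       rewrite (proj2 (Nat.eqb_neq n 1) E1), (proj2 (Nat.eqb_neq n (S p)) E2).
       change zero with 0; Rring. }
  cbv beta in H2; rewrite !Nat.eqb_refl in H2.
  rewrite (proj2 (Nat.eqb_neq (S p) 1)) in H2 by lia.
  assert (H3 := is_series_plus _ _ _ _ H2 (is_series_scal A _ _ H1)).
  apply is_series_unique in H3.
  rewrite (Series_ext _ (fun n => Cmod (c n) * r ^ n)) in H3.
  2: { intros n; rewrite (extremal_Cmod_rec p A c Hp HA Hc n).
       change plus with Rplus; change scal with Rmult; Rring. }
  change (L = (A * r ^ 1 + (1 - 2 * A ^ 2) * r ^ S p) + A * (r ^ p * L)) in H3.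
  simpl (r ^ 1) in H3; simpl (r ^ S p) in H3; lra.
Qed.

(** The equation says, through [extremal_majorant], that the extremal majorant is exactly 1 at
    [rp]. *)
Lemma extremal_a_facts (p : nat) (rp : R) :
  (1 <= p)%nat -> is_rp p rp ->
  let A := extremal_a p rp in
  0 < A < 1 /\ A * rp + (1 - 2 * A ^ 2) * (rp * rp ^ p) = 1 - A * rp ^ p.
Proof.
  intros Hp Hrp A.
  destruct (is_rp_facts p rp Hp Hrp) as [Hxy [Hy [Hx [Hx2 Hdisc]]]].
  destruct Hrp as [Hr _].
  set (x := rp ^ p) in *; set (y := rp ^ (p - 1)) in *.
  assert (Hsqrt : sqrt (1 - rp ^ (2 * p)) / sqrt 2 = (3 - y) / 4).
  { rewrite Nat.mul_comm, pow_mult; fold x.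
    rewrite <- sqrt_div by lra.
    apply sqrt_lem_1; [lra|lra|].
    replace ((3 - y) / 4 * ((3 - y) / 4)) with ((3 - y) ^ 2 / 16) by field.
    rewrite Hdisc; field. }
  assert (HAx : A * x = (1 + y) / 4).
  { unfold A, extremal_a; rewrite Hsqrt; fold x; field; lra. }
  assert (HA0 : 0 < A) by nra.
  assert (HA1 : A < 1).
  (* As [((3 - y) / 4)^2 = (1 - x^2) / 2], this is equivalent to [x > 1/3]; it says
     [1 - x < 1 - A x]. *)
  { assert (1 - x < (3 - y) / 4) by nra.
    nra. }
  split; [lra|].
  apply (Rmult_eq_reg_l y); [|lra].
  replace (y * (A * rp + (1 - 2 * A ^ 2) * (rp * x)))
    with (A * (rp * y) + (1 - 2 * A ^ 2) * ((rp * y) * x)) by ring.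
  rewrite <- Hxy.
  replace (A * x + (1 - 2 * A ^ 2) * (x * x)) with (A * x + x ^ 2 - 2 * (A * x) ^ 2) by ring.
  rewrite HAx; nra.
Qed.

Theorem theorem1 (p : nat) (hp : (1 <= p)%nat) (rp : R) (hrp : is_rp p rp) :
  (forall a : nat -> C,
     analytic_in_disk a -> p_symmetric p a -> bounded_by_one_in_disk a ->
     forall r : R, 0 <= r <= rp -> bohr_majorant a r <= 1)
  /\
  (forall c : nat -> C,
     (forall z : C, Cmod z < 1 ->
        is_series (fun n => (c n * z ^ n)%C) (extremal_f p (extremal_a p rp) z)) ->
     bohr_majorant c rp <= 1 /\
     (forall r : R, rp < r < 1 -> 1 < bohr_majorant c r)).
Proof.
  assert (Hr := proj1 hrp).
  split.
  - intros a Ha Hsym Hb r Hrr.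
    apply Rle_trans with (bohr_majorant a rp).
    + apply Series_le; [|apply analytic_abs_summable; [exact Ha|lra]].
      intros n; assert (0 <= Cmod (a n)) by apply Cmod_ge_0; split.
      * apply Rmult_le_pos; [assumption|apply pow_le; lra].
      * apply Rmult_le_compat_l; [assumption|apply pow_incr; lra].
    + now apply (bohr_majorant_le_1 p).
  - intros c Hc.
    destruct (extremal_a_facts p rp hp hrp) as [HA Heq].
    destruct (is_rp_facts p rp hp hrp) as [_ [_ [Hx _]]].
    set (A := extremal_a p rp) in *.
    split.
    + assert (H := extremal_majorant p A rp c hp HA ltac:(lra) Hc).
      rewrite Heq in H; assert (0 < 1 - A * rp ^ p) by nra; nra.
    + intros r Hrr.
      assert (H := extremal_majorant p A r c hp HA ltac:(lra) Hc).
      set (x := rp ^ p) in *; set (X := r ^ p) in *.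
      assert (HxX : x <= X) by (apply pow_incr; lra).
      assert (HX1 : X <= 1) by (rewrite <- (pow1 p); apply pow_incr; lra).
      assert (HAX : 0 < 1 - A * X) by nra.
      (* The majorant exceeds 1 at [r] exactly when [(1 - A X)(1 - r A) < r (1 - A^2) X]. Equality
         holds at [rp]; beyond it the left side does not grow and the right side increases
         strictly. *)
      assert (Heq2 : (1 - A * x) * (1 - rp * A) = rp * (1 - A ^ 2) * x) by lra.
      assert (Hlt1 : (1 - A * X) * (1 - r * A) <= (1 - A * x) * (1 - rp * A)).
      { apply Rmult_le_compat; nra. }
      assert (HA2 : 0 < 1 - A ^ 2) by nra.
      assert (Hlt2 : rp * (1 - A ^ 2) * x < r * (1 - A ^ 2) * X).
      { apply Rlt_le_trans with (r * (1 - A ^ 2) * x).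
        - apply Rmult_lt_compat_r; [lra|]; apply Rmult_lt_compat_r; lra.
        - apply Rmult_le_compat_l; [|exact HxX]; apply Rmult_le_pos; lra. }
      apply (Rmult_lt_reg_r (1 - A * X)); [exact HAX|].
      rewrite H; lra.
Qed.
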